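(* MB Dom Game has a linear kernel when parameterized by the neighborhood diversity of the input graph.
   Context: All graphs are finite, simple and undirected. The Maker-Breaker domination game on a graph $G$ is played by Dominator and Staller, who alternately claim one unclaimed vertex of $G$. Dominator wins if the vertices she claims contain a dominating set of $G$; otherwise Staller wins. MB Dom Game is the problem: given a graph $G$ and the first player (Dominator or Staller), decide which player has a winning strategy in the Maker-Breaker domination game on $G$ with the given player moving first. Two vertices $u,v$ have the same type if $\{u,v\}$ is a module, i.e. $N(u)\setminus\{v\}=N(v)\setminus\{u\}$. The neighborhood diversity of $G=(V,E)$ is the minimum integer $w$ such that $V$ can be partitioned into $w$ sets $V_1,\dots,V_w$, each $V_i$ being a set of vertices of the same type, i.e. a module inducing either a clique or a stable set. A linear kernel for a problem with parameter $w$ is a polynomial-time algorithm transforming every instance into an equivalent instance of the same problem (same winner) whose graph has $O(w)$ vertices. *)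

(* Defs.v *)
From mathcomp Require Import all_boot.

Set Implicit Arguments.
Unset Strict Implicit.
Unset Printing Implicit Defensive.

(* The vertex set is {0, ..., order - 1}, so that a graph can be written down
   as the input of a program. *)
Record graph := Graph {
  order : nat;
  adj : rel 'I_order;
  adj_sym : symmetric adj;
  adj_irr : irreflexive adj }.

Definition vertex (G : graph) : finType := 'I_(order G).

Definition nbhd (G : graph) (v : vertex G) : {set vertex G} :=
  [set u | adj v u].

Definition same_type (G : graph) (u v : vertex G) : bool :=
  nbhd u :\ v == nbhd v :\ u.

Definition type_partition (G : graph) (P : {set {set vertex G}}) : bool :=
  partition P [set: vertex G] &&
  [forall A in P, forall u in A, forall v in A, same_type u v].

Lemma type_partition_exists (G : graph) :
  exists w, [exists P : {set {set vertex G}}, type_partition P && (#|P| == w)].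
Proof.
pose P := preim_partition (@id (vertex G)) setT.
exists #|P|; apply/existsP; exists P; rewrite eqxx andbT.
apply/andP; split; first exact: preim_partitionP.
apply/forall_inP => A /imsetP[x _ ->].
apply/forall_inP => u; rewrite !inE => /eqP <-.
by apply/forall_inP => v; rewrite !inE => /eqP <-; apply: eqxx.
Qed.

Definition neighborhood_diversity (G : graph) : nat :=
  ex_minn (type_partition_exists G).

Definition dominating (G : graph) (D : {set vertex G}) : bool :=
  [forall v, (v \in D) || [exists u in D, adj u v]].

Inductive player := Dominator | Staller.

Definition opponent (X : player) : player :=
  match X with Dominator => Staller | Staller => Dominator end.

Definition is_dominator (X : player) : bool :=
  match X with Dominator => true | Staller => false end.

(* The player making move number i, counted from 0, when [first] starts. *)
Definition turn (first : player) (i : nat) : player :=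
  if odd i then opponent first else first.

(* A play is recorded as the sequence of claimed vertices, in order. *)
Definition complete_play (G : graph) (p : seq (vertex G)) : Prop :=
  uniq p /\ size p = order G.

Definition dominator_claims (G : graph) (first : player) (p : seq (vertex G)) :
    {set vertex G} :=
  [set v in p | is_dominator (turn first (index v p))].

Definition winner (G : graph) (first : player) (p : seq (vertex G)) : player :=
  if [exists D : {set vertex G},
        (D \subset dominator_claims first p) && dominating D]
  then Dominator else Staller.

(* A strategy maps the moves made so far to the next move.  It is
   option-valued because no move exists in a finished play (nor, on the graph
   with no vertex, any vertex to return). *)
Definition strategy (G : graph) := seq (vertex G) -> option (vertex G).

(* Without this requirement, a strategy proposing claimed vertices would be
   vacuously winning. *)
Definition legal_strategy (G : graph) (first X : player) (s : strategy G) :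
    Prop :=
  forall h : seq (vertex G), uniq h -> size h < order G ->
    turn first (size h) = X -> exists2 v, s h = Some v & v \notin h.

Definition follows (G : graph) (first X : player) (s : strategy G)
    (p : seq (vertex G)) : Prop :=
  forall i, i < size p -> turn first i = X -> s (take i p) = onth p i.

Definition has_winning_strategy (G : graph) (first X : player) : Prop :=
  exists s : strategy G, legal_strategy first X s /\
    forall p, complete_play p -> follows first X s p -> winner first p = X.

(* The model of computation is a random access machine, programmed with structured control
   flow: finitely many registers are used by a given program, and there is an
   unbounded memory with indirect addressing.  Each command and each test costs
   one unit; the size of the expressions in a program does not depend on the
   input.  Multiplication is not primitive: with it, the unit cost measure would
   not be polynomially related to the time of Turing machines. *)

Inductive expr :=
  | Lit of nat
  | Reg of nat
  | Read of expr
  | Plus of expr & expr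
  | Minus of expr & expr.

Inductive cmd :=
  | Skip
  | Assign of nat & expr
  | Store of expr & expr
  | Seq of cmd & cmd
  | If of expr & cmd & cmd
  | While of expr & cmd.

Record state := State { regs : nat -> nat; mem : nat -> nat }.

Definition update (f : nat -> nat) (a v : nat) : nat -> nat :=
  fun b => if b == a then v else f b.

(* Subtraction is truncated; a test succeeds when its value is nonzero. *)
Fixpoint eval (s : state) (e : expr) : nat :=
  match e with
  | Lit n => n
  | Reg r => regs s r
  | Read e1 => mem s (eval s e1)
  | Plus e1 e2 => eval s e1 + eval s e2
  | Minus e1 e2 => eval s e1 - eval s e2
  end.

(* [exec c s t s']: started in state s, c halts in state s' after t steps. *)
Inductive exec : cmd -> state -> nat -> state -> Prop :=
  | ExecSkip s : exec Skip s 1 s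
  | ExecAssign r e s :
      exec (Assign r e) s 1 (State (update (regs s) r (eval s e)) (mem s))
  | ExecStore a e s :
      exec (Store a e) s 1
        (State (regs s) (update (mem s) (eval s a) (eval s e)))
  | ExecSeq c1 c2 s s1 s2 t1 t2 :
      exec c1 s t1 s1 -> exec c2 s1 t2 s2 -> exec (Seq c1 c2) s (t1 + t2) s2
  | ExecIfTrue e c1 c2 s s1 t :
      eval s e != 0 -> exec c1 s t s1 -> exec (If e c1 c2) s t.+1 s1
  | ExecIfFalse e c1 c2 s s1 t :
      eval s e == 0 -> exec c2 s t s1 -> exec (If e c1 c2) s t.+1 s1
  | ExecWhileTrue e c s s1 s2 t1 t2 :
      eval s e != 0 -> exec c s t1 s1 -> exec (While e c) s1 t2 s2 ->
      exec (While e c) s (t1 + t2).+1 s2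
  | ExecWhileFalse e c s :
      eval s e == 0 -> exec (While e c) s 1 s.

Definition initial_state (input : seq nat) : state :=
  State (fun _ => 0) (nth 0 input).

Definition outputs (s : state) (out : seq nat) : Prop :=
  forall i, i < size out -> mem s i = nth 0 out i.

Record instance := Instance { igraph : graph; ifirst : player }.

(* The order, the first player, then the adjacency matrix row by row.  The
   length, order ^ 2 + 2, bounds every entry, so it is a legitimate measure of
   the input size; and the order makes the encoding self-delimiting. *)
Definition encode (I : instance) : seq nat :=
  [:: order (igraph I), nat_of_bool (is_dominator (ifirst I)) &
    [seq nat_of_bool (@adj (igraph I) u v) |
       u <- enum 'I_(order (igraph I)), v <- enum 'I_(order (igraph I))]].

Definition polynomial_time (f : instance -> instance) : Prop :=
  exists (c : cmd) (a k : nat), forall I : instance,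
    exists (t : nat) (s : state),
      [/\ exec c (initial_state (encode I)) t s,
          outputs s (encode (f I)) &
          t <= a * size (encode I) ^ k].

Definition equivalent_instances (I J : instance) : Prop :=
  forall X : player,
    has_winning_strategy (igraph I) (ifirst I) X <->
    has_winning_strategy (igraph J) (ifirst J) X.

Definition linear_kernel (param : instance -> nat) (f : instance -> instance) :
    Prop :=
  [/\ polynomial_time f,
      forall I, equivalent_instances I (f I) &
      exists C : nat, forall I, order (igraph (f I)) <= C * param I].

(* Main.v *)
From mathcomp Require Import all_boot zify.
Require Import Defs.

(* The kernel keeps, in every type class, the two vertices of smallest index.
   Deleting a third twin c of a and b does not change the winner.  With the pair
   {a, b} on the board, Dominator can pair a with b and so claims one of them:
   the closed neighbourhoods containing both are hit for free.  Conversely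
   Staller, pairing a with b, claims one of them as well, so if a and b are
   nonadjacent she only needs their common open neighbourhood.  Hence a and b can
   be taken off the board, provided the vertices adjacent to a or b are forgotten
   and N(a) is kept as a winning set when a and b are nonadjacent.  In that
   reduced game c is a dummy vertex, and adding or removing dummies does not
   matter, because an extra move never hurts. *)

Set Implicit Arguments.
Unset Strict Implicit.
Unset Printing Implicit Defensive.

(** * Positional games *)

Section PositionalGame.

Variable T : finType.
Implicit Types (W : pred {set T}) (A B F S : {set T}).

(* Seen from one player, with goal [W]: [A] is what this player has claimed, [F]
   is unclaimed, and [mine] tells whether it is this player's turn.  The
   opponent's vertices need not be recorded. *)
Fixpoint win_rec k W (mine : bool) A F : bool :=
  if k is k'.+1 then
    if mine then [exists x in F, win_rec k' W false (x |: A) (F :\ x)]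
    else [forall x in F, win_rec k' W true A (F :\ x)]
  else W A.

Definition win W mine A F := win_rec #|F| W mine A F.

Definition increasing W := forall A B, A \subset B -> W A -> W B.

Lemma win0 W b A : win W b A set0 = W A.
Proof. by rewrite /win cards0. Qed.

Lemma win_mineP W A F : F != set0 ->
  reflect (exists2 x, x \in F & win W false (x |: A) (F :\ x))
          (win W true A F).
Proof.
rewrite -card_gt0 /win; case E: #|F| => [//|k] _ /=.
have Ek x : x \in F -> #|F :\ x| = k by move=> xF; move: E; rewrite (cardsD1 x) xF => -[].
by apply: (iffP exists_inP) => -[x xF wx]; exists x => //; move: wx; rewrite Ek.
Qed.

Lemma win_oppP W A F : F != set0 ->
  reflect (forall x, x \in F -> win W true A (F :\ x)) (win W false A F).
Proof.
rewrite -card_gt0 /win; case E: #|F| => [//|k] _ /=.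
have Ek x : x \in F -> #|F :\ x| = k by move=> xF; move: E; rewrite (cardsD1 x) xF => -[].
by apply: (iffP forall_inP) => wF x xF; move: (wF x xF); rewrite Ek.
Qed.

Lemma setD1_ind (P : {set T} -> Prop) :
  (forall F, (forall x, x \in F -> P (F :\ x)) -> P F) -> forall F, P F.
Proof.
move=> step F; have [k] := ubnP #|F|; elim: k F => // k IH F; rewrite ltnS => leFk.
apply: step => x xF; apply: IH; apply: leq_trans leFk.
by rewrite (cardsD1 x F) xF.
Qed.

(** The same moves work for both goals. Goals are compared only on final positions [A :|: S] and
    [B :|: S] with [S] inside the board, so that later uses may exploit what lies on the board. *)
Lemma win_mono W1 W2 b A B F :
    (forall S, S \subset F -> W1 (A :|: S) -> W2 (B :|: S)) ->
  win W1 b A F -> win W2 b B F.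
Proof.
elim/setD1_ind: F => F IH in b A B * => W12.
have [F0|F0] := eqVneq F set0.
  by have := W12 set0 (sub0set _); rewrite F0 !win0 !setU0.
case: b => [/win_mineP-/(_ F0)[x xF wx]|/win_oppP-/(_ F0) wF].
  apply/win_mineP => //; exists x => //; apply: IH wx => // S SF.
  rewrite -!setUA !(setUCA [set x]); apply: W12.
  by rewrite subUset sub1set xF (subset_trans SF) ?subsetDl.
apply/win_oppP => // x xF; apply: IH (wF x xF) => // S SF.
by apply: W12; rewrite (subset_trans SF) ?subsetDl.
Qed.

Lemma setD1C F x y : F :\ x :\ y = F :\ y :\ x.
Proof. by rewrite !setDDl setUC. Qed.

(** An extra move never hurts: the player follows the old strategy, pretending that [x] is still
    free. *)
Lemma win_extra W b A F x : increasing W -> x \in F ->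
  win W b A F -> win W b (x |: A) (F :\ x).
Proof.
move=> incW; elim/setD1_ind: F => F IH in b A x * => xF.
have F0 : F != set0 by apply/set0Pn; exists x.
have [E|Fx0] := eqVneq (F :\ x) set0.
  have inF y : y \in F -> y = x.
    move=> yF; apply/eqP; case: eqVneq => // yx.
    by move/setP/(_ y): E; rewrite !inE yx yF.
  rewrite E win0; case: b => [/win_mineP-/(_ F0)[y /inF ->]|/win_oppP-/(_ F0 x xF)].
    by rewrite E win0.
  by rewrite E win0; apply: incW; apply: subsetUr.
case: b => [/win_mineP-/(_ F0)[y yF wy]|/win_oppP-/(_ F0) wF].
  apply/win_mineP => //; have [yx|yx] := eqVneq y x.
    (* The old strategy asks for [x], which is already owned. Any other free [z] is claimed instead
       and becomes the new extra vertex. *)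
    have [z zF] := set0Pn _ Fx0; exists z => //; subst y.
    exact: IH.
  exists y; first by rewrite !inE yx.
  by rewrite setUCA (setD1C F x); apply: IH wy => //; rewrite !inE eq_sym yx.
apply/win_oppP => // y; rewrite !inE => /andP[yx yF].
by rewrite (setD1C F x); apply: IH; rewrite ?wF // !inE eq_sym yx.
Qed.

Lemma win_tempo W A F : increasing W -> win W false A F -> win W true A F.
Proof.
move=> incW; have [->|F0] := eqVneq F set0; first by rewrite !win0.
have [x xF] := set0Pn _ F0 => wF; apply/win_mineP => //; exists x => //.
exact: win_extra.
Qed.

Lemma setU1_neq0 x F : x |: F != set0.
Proof. by apply/set0Pn; exists x; rewrite setU11. Qed.

Lemma setU1DU1 x y F : x != y -> (x |: F) :\ y = x |: (F :\ y).
Proof.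
move=> xy; apply/setP => z; rewrite !inE; have [->|//] := eqVneq z x.
by rewrite xy.
Qed.

(** If the opponent claims the new vertex, the turn comes back on the old board, which is a gain of
    tempo. The player claims it only when nothing else is left. *)
Lemma win_add_dummy W b A F x : increasing W -> x \notin F ->
  win W b A F -> win W b A (x |: F).
Proof.
move=> incW; elim/setD1_ind: F => F IH in b A * => xF.
have neq y : y \in F -> x != y by apply: contraTneq => <-.
case: b => wF; last first.
  apply/win_oppP => [|y]; first exact: setU1_neq0.
  rewrite !inE => /predU1P[->|yF].
    by rewrite setU1K //; apply: win_tempo.
  rewrite setU1DU1 ?neq //; apply: IH => //; first by rewrite !inE (negPf xF) andbF.
  by move/win_oppP: wF; apply=> //; apply/set0Pn; exists y.
apply/win_mineP; first exact: setU1_neq0.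
have [F0|F0] := eqVneq F set0.
  exists x; rewrite ?setU11 // setU1K //.
  move: wF; rewrite F0 !win0; apply: incW; exact: subsetUr.
move/win_mineP: wF => /(_ F0)[y yF wy]; exists y; first by rewrite !inE yF orbT.
by rewrite setU1DU1 ?neq //; apply: IH; rewrite // !inE (negPf xF) andbF.
Qed.

(** Where the strategy spends a move on [x], the player gains nothing from it, so the same position
    is won with the opponent to move, and by [win_tempo] also with the move in hand. *)
Lemma win_drop_dummy W b A F x : increasing W ->
    (forall S, W (x |: S) = W S) -> x \notin F ->
  win W b A (x |: F) -> win W b A F.
Proof.
move=> incW Wx; elim/setD1_ind: F => F IH in b A * => xF.
have neq y : y \in F -> x != y by apply: contraTneq => <-.
case: b => [/win_mineP-/(_ (setU1_neq0 x F))[y]|/win_oppP-/(_ (setU1_neq0 x F)) wF].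
  rewrite !inE => /predU1P[->|yF].
    rewrite setU1K // => wF; apply: win_tempo => //.
    by apply: win_mono wF => S _; rewrite -setUA Wx.
  rewrite setU1DU1 ?neq // => wy; apply/win_mineP; first by apply/set0Pn; exists y.
  by exists y => //; apply: IH; rewrite // !inE (negPf xF) andbF.
have [F0|F0] := eqVneq F set0.
  by have := wF x (setU11 _ _); rewrite setU1K // F0 !win0.
apply/win_oppP => // y yF; apply: IH; rewrite //; first by rewrite !inE (negPf xF) andbF.
by rewrite -setU1DU1 ?neq // wF // !inE yF orbT.
Qed.

(** Pairing strategy: [x] is answered by [y] and conversely, and the winning strategy for [W1] is
    played on [F]. Since either vertex of the pair may be the one obtained, [W2] is required for
    both. *)
Lemma win_pairing W1 W2 b A F x y : x != y -> x \notin F -> y \notin F ->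
    (forall S, S \subset F -> W1 (A :|: S) ->
       W2 (x |: (A :|: S)) && W2 (y |: (A :|: S))) ->
  win W1 b A F -> win W2 b A (x |: (y |: F)).
Proof.
move=> xy; elim/setD1_ind: F => F IH in b A * => xF yF W12.
have neqx z : z \in F -> x != z by apply: contraTneq => <-.
have neqy z : z \in F -> y != z by apply: contraTneq => <-.
have xyF : x \notin y |: F by rewrite !inE negb_or xy.
(* A move [z] inside [F], by either player, leaves the pair intact; this is the inductive case. *)
have reply c A' z : z \in F -> A' \in [:: A; z |: A] -> win W1 c A' (F :\ z) ->
    win W2 c A' ((x |: (y |: F)) :\ z).
  move=> zF A'E w; rewrite !setU1DU1 ?neqx ?neqy //.
  apply: IH; rewrite // ?inE ?negb_and ?negbK ?xF ?yF ?orbT // => S SF.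
  have SF' := subset_trans SF (subsetDl F [set z]).
  move: A'E; rewrite !inE => /orP[]/eqP->; first exact: W12.
  by rewrite -setUA setUCA; apply: W12; rewrite subUset sub1set zF.
case: b => wF; last first.
  apply/win_oppP => [|z]; first exact: setU1_neq0.
  rewrite !inE => /or3P[/eqP->|/eqP->|zF].
  - rewrite setU1K //; apply/win_mineP; first exact: setU1_neq0.
    exists y; rewrite ?setU11 // setU1K //; apply: win_mono wF => S /W12 W /W.
    by rewrite -setUA => /andP[].
  - rewrite setUCA setU1K; last by rewrite !inE negb_or eq_sym xy.
    apply/win_mineP; first exact: setU1_neq0.
    exists x; rewrite ?setU11 // setU1K //; apply: win_mono wF => S /W12 W /W.
    by rewrite -setUA => /andP[].
  apply: reply => //; rewrite ?inE ?eqxx //; move/win_oppP: wF; apply=> //.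
  by apply/set0Pn; exists z.
apply/win_mineP; first exact: setU1_neq0.
have [F0|F0] := eqVneq F set0.
  (* Only the pair is left and the player must break it: [x] is claimed and the opponent gets
     [y]. *)
  exists x; rewrite ?setU11 // setU1K // F0; apply/win_oppP; first exact: setU1_neq0.
  move=> z; rewrite !inE orbF => /eqP->; rewrite setU1K ?inE // win0.
  move: wF; rewrite F0 win0; have := W12 set0 (sub0set _).
  by rewrite setU0 => W /W/andP[].
move/win_mineP: wF => /(_ F0)[z zF wz]; exists z; first by rewrite !inE zF !orbT.
by apply: reply; rewrite ?inE ?eqxx ?orbT.
Qed.

(** Determinacy: exactly one player wins. If one player obtains [S] from the board, the other
    obtains [F :\: S], so complementary goals exchange the two quantifiers over moves. *)
Lemma win_dual W1 W2 b A B F :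
    (forall S, S \subset F -> W2 (B :|: S) = ~~ W1 (A :|: (F :\: S))) ->
  win W2 (~~ b) B F = ~~ win W1 b A F.
Proof.
elim/setD1_ind: F => F IH in b A B * => W12.
have [F0|F0] := eqVneq F set0.
  by have := W12 set0 (sub0set _); rewrite F0 !win0 setDv !setU0.
case: b => /=.
  have mv x : x \in F -> win W2 true B (F :\ x) = ~~ win W1 false (x |: A) (F :\ x).
    move=> xF; apply: (IH x xF false) => S SF.
    rewrite W12; last by apply: subset_trans SF (subsetDl _ _).
    congr (~~ W1 _); rewrite -setUA setUCA; congr (_ :|: _).
    apply/setP => z; rewrite !inE; have [->|//] := eqVneq z x.
    by rewrite xF andbT; apply/negP => /(subsetP SF); rewrite !inE eqxx.
  apply/idP/negP => [/win_oppP-/(_ F0) H /win_mineP-/(_ F0)[x xF]|H].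
    by apply/negP; rewrite -mv // H.
  apply/win_oppP => // x xF; rewrite mv //; apply/negP => wx; apply: H.
  by apply/win_mineP => //; exists x.
have mv x : x \in F -> win W2 false (x |: B) (F :\ x) = ~~ win W1 true A (F :\ x).
  move=> xF; apply: (IH x xF true) => S SF.
  rewrite -setUA setUCA W12.
    by congr (~~ W1 (_ :|: _)); rewrite setDDl.
  by rewrite subUset sub1set xF (subset_trans SF (subsetDl _ _)).
apply/idP/negP => [/win_mineP-/(_ F0)[x xF wx] /win_oppP-/(_ F0) H|H].
  by move: wx; rewrite mv // H.
have [x xF wx] : exists2 x, x \in F & ~~ win W1 true A (F :\ x).
  apply/exists_inP; rewrite -negb_forall_in; apply/negP => /forall_inP wF.
  by apply: H; apply/win_oppP.
by apply/win_mineP => //; exists x => //; rewrite mv.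
Qed.

End PositionalGame.

Lemma win_imset (T T' : finType) (f : T -> T') (W : pred {set T'}) b
    (A F : {set T}) : injective f ->
  win W b (f @: A) (f @: F) = win (fun S : {set T} => W (f @: S)) b A F.
Proof.
move=> injf; elim/setD1_ind: F => F IH in b A *.
have [->|F0] := eqVneq F set0; first by rewrite imset0 !win0.
have imset_setU1 x (S : {set T}) : f @: (x |: S) = f x |: f @: S.
  by rewrite imsetU imset_set1.
have fF0 : f @: F != set0 by rewrite imset_eq0.
have fD x : (f @: F) :\ f x = f @: (F :\ x).
  apply/setP => y; apply/idP/imsetP => [|[z]]; rewrite !inE.
    move=> /andP[yx /imsetP[z zF E]]; exists z; rewrite // !inE zF andbT.
    by apply: contraNneq yx => <-; rewrite E.
  by move=> /andP[zx zF] ->; rewrite (inj_eq injf) zx imset_f.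
case: b.
  apply/win_mineP/win_mineP => // [[_ /imsetP[x xF ->]]|[x xF]].
    by rewrite fD -imset_setU1 IH //; exists x.
  by exists (f x); rewrite ?imset_f // fD -imset_setU1 IH.
apply/win_oppP/win_oppP => // H x; last first.
  by case/imsetP => {}x xF ->; rewrite fD IH // H.
by move=> xF; rewrite -IH // -fD H // imset_f.
Qed.

(** * The domination game as a positional game *)

(** Players are compared through booleans, which gives a test usable in sets and conditionals. *)
Definition mine (first X : player) (i : nat) : bool :=
  is_dominator (turn first i) == is_dominator X.

Lemma mineP first X i : reflect (turn first i = X) (mine first X i).
Proof. by rewrite /mine; case: turn X => -[]; constructor. Qed.

Lemma mineS first X i : mine first X i.+1 = ~~ mine first X i.
Proof. by rewrite /mine /turn /=; case: odd first X => -[] []. Qed.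

Section GraphGame.

Variable G : graph.
Implicit Types (X first : player) (p : seq (vertex G)) (S : {set vertex G}).

(** At the end every vertex is claimed, so Dominator owns the complement of Staller's set [S]. *)
Definition goal X S : bool :=
  if X is Dominator then dominating S else ~~ dominating (~: S).

Definition claims X first p : {set vertex G} :=
  [set v in p | mine first X (index v p)].

Definition free p : {set vertex G} := ~: [set v in p].

Lemma dominatingS S S' : S \subset S' -> dominating S -> dominating S'.
Proof.
move=> sSS' /forallP domS; apply/forallP => v; case/orP: (domS v) => [vS|].
  by rewrite (subsetP sSS').
case/exists_inP => u uS uv; apply/orP; right.
by apply/exists_inP; exists u; rewrite ?(subsetP sSS').
Qed.

Lemma winnerP X first p : complete_play p ->
  (winner first p = X) <-> goal X (claims X first p).
Proof.
move=> [up sp]; rewrite /winner.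
have -> : [exists D : {set vertex G},
    (D \subset dominator_claims first p) && dominating D] =
    dominating (dominator_claims first p).
  (* Supersets of dominating sets are dominating, so the set of all Dominator's vertices can serve
     as [D]. *)
  apply/existsP/idP => [[D /andP[]]|domp]; first exact: dominatingS.
  by exists (dominator_claims first p); rewrite subxx.
have inp v : v \in p.
  apply: contraT => vp; have := max_card [in v :: p].
  by rewrite card_ord (card_uniqP _) /= ?vp ?up // sp ltnn.
case: X => /=.
  suff -> : claims Dominator first p = dominator_claims first p by case: ifP.
  by apply/setP => v; rewrite !inE /mine eqb_id.
suff -> : ~: claims Staller first p = dominator_claims first p by case: ifP.
by apply/setP => v; rewrite !inE /mine inp /=; case: is_dominator.
Qed.

Lemma claims_rcons X first p v : v \notin p ->
  claims X first (rcons p v) =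
  if mine first X (size p) then v |: claims X first p else claims X first p.
Proof.
move=> vp; apply/setP => u; rewrite (fun_if (fun S => u \in S)) !inE mem_rcons inE.
rewrite -cats1 index_cat /=.
have [->|uv] := eqVneq u v.
  rewrite (negPf vp) ?eqxx addn0 /=.
  by case: ifP.
by rewrite /=; case: (u \in p); case: ifP.
Qed.

Lemma free_rcons p v : free (rcons p v) = free p :\ v.
Proof. by apply/setP => u; rewrite !inE mem_rcons inE negb_or. Qed.

Lemma follows_rcons X first s p v :
  follows first X s (rcons p v) <->
  follows first X s p /\ (turn first (size p) = X -> s p = Some v).
Proof.
split=> [H|[H Hv] i].
  split=> [i ip|] tX.
    have := H i; rewrite size_rcons ltnS ltnW // => /(_ isT tX).
    by rewrite -cats1 take_cat onth_cat ip.
  have := H (size p); rewrite size_rcons ltnSn => /(_ isT tX).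
  by rewrite -cats1 take_cat onth_cat ltnn subnn /= cats0.
rewrite size_rcons ltnS leq_eqVlt => /predU1P[->|ip] tX.
  by rewrite -cats1 take_cat onth_cat ltnn subnn /= cats0 Hv.
by rewrite -cats1 take_cat onth_cat ip H.
Qed.

Lemma size_free p : uniq p -> size p + #|free p| = order G.
Proof.
move=> up; rewrite /free -[RHS]card_ord -(cardsC [set v in p]); congr (_ + _).
by rewrite cardsE (card_uniqP up).
Qed.

(** This replaces strategies, which are functions of histories, by the recursive game, where
    positions can be handled by induction on the free vertices. *)
Lemma has_winning_strategyP X first :
  has_winning_strategy G first X <->
  win (goal X) (mine first X 0) set0 [set: vertex G].
Proof.
have claims0 : claims X first [::] = set0 by apply/setP => v; rewrite !inE.
have free0 : free [::] = setT by apply/setP => v; rewrite !inE.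
split=> [[s [legal win_s]]|wins].
  suff: forall F p, free p = F -> uniq p -> follows first X s p ->
    win (goal X) (mine first X (size p)) (claims X first p) F.
    by move=> /(_ _ [::] free0); rewrite claims0; apply.
  elim/setD1_ind => F IH p EF up fp; have [F0|F0] := eqVneq F set0.
    have cp : complete_play p.
      by split=> //; rewrite -(size_free up) EF F0 cards0 addn0.
    by rewrite F0 win0; apply/winnerP => //; apply: win_s.
  have step v : v \in F -> (turn first (size p) = X -> s p = Some v) ->
      win (goal X) (mine first X (size p).+1) (claims X first (rcons p v)) (F :\ v).
    move=> vF sv; rewrite -(size_rcons p v); apply: IH => //.
    - by rewrite free_rcons EF.
    - by rewrite rcons_uniq up andbT; move: vF; rewrite -EF !inE.
    - exact/follows_rcons.
  have notin v : v \in F -> v \notin p by rewrite -EF !inE.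
  case: (mineP first X (size p)) step => [tX|tX] step.
    have [|v sv vp] := legal p up _ tX.
      by rewrite -(size_free up) EF -[X in X < _]addn0 ltn_add2l card_gt0.
    have vF : v \in F by rewrite -EF !inE.
    apply/win_mineP => //; exists v => //; have := step v vF (fun=> sv).
    rewrite claims_rcons // mineS; by case: mineP.
  apply/win_oppP => // v vF; have := step v vF; rewrite claims_rcons ?notin // mineS.
  by case: mineP => // _; apply.
(* In the other direction, the strategy claims a vertex that keeps the position won. On histories
   where there is none it takes any free vertex, which keeps it legal everywhere. *)
pose good h v := (v \notin h) &&
  win (goal X) false (v |: claims X first h) (free h :\ v).
pose s : strategy G := fun h =>
  if [pick v | good h v] is Some v then Some v else [pick v | v \notin h].
exists s; split=> [h uh sh tX|p cp fp].
  rewrite /s; case: pickP => [v /andP[vh _]|_]; first by exists v.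
  case: pickP => [v vh|no]; first by exists v.
  have : 0 < #|free h| by rewrite -(ltn_add2l (size h)) addn0 size_free.
  by case/card_gt0P => v; rewrite !inE no.
have [up sp] := cp; apply/winnerP => //.
(* Invariant: every prefix of a play that follows [s] leads to a won position. *)
suff: forall i, i <= size p -> win (goal X) (mine first X i)
    (claims X first (take i p)) (free (take i p)).
  move=> /(_ _ (leqnn _)); rewrite take_size.
  have /eqP : #|free p| = 0.
    by apply/eqP; rewrite -(eqn_add2l (size p)) size_free // sp addn0.
  by rewrite cards_eq0 => /eqP->; rewrite win0.
elim=> [_|i IH ip]; first by rewrite take0 claims0 free0.
have := IH (ltnW ip); have fi := fp i ip.
have [v vi] : exists v, onth p i = Some v.
  by move: ip; rewrite -onthTE; case: onth => // v; exists v.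
have ti : take i.+1 p = rcons (take i p) v.
  by rewrite (take_nth v) // -odflt_onth vi.
have : uniq (rcons (take i p) v) by rewrite -ti take_uniq.
rewrite rcons_uniq => /andP[vp _].
have vF : v \in free (take i p) by rewrite !inE.
have F0 : free (take i p) != set0 by apply/set0Pn; exists v.
rewrite ti free_rcons claims_rcons // size_take ip mineS.
case: mineP fi => [tX /(_ tX)|_ _ /win_oppP]; last exact.
rewrite /s vi; case: pickP => [w /andP[_ ww] [<-]|no _] //.
case/win_mineP => // w; rewrite inE in_set => wp ww; have := no w.
by rewrite /good wp ww.
Qed.

End GraphGame.

(** * Deleting twins *)

Section Twins.

Variable G : graph.
Implicit Types (a b c u v : vertex G) (U S : {set vertex G}).

(** For [S] inside [U], this is domination of the subgraph induced by [U], expressed without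
    changing the vertex type. *)
Definition hits U S : bool :=
  [forall v in U, [exists u in S, (u == v) || adj u v]].

(** Dominator's goal once the twins [a] and [b] are off the board. If they are nonadjacent, the
    conditions at [a] and [b] survive and, as [S] then avoids both, ask for a common neighbour. *)
Definition hits_off a b U S : bool :=
  [forall v in U, [|| adj v a, adj v b | [exists u in S, (u == v) || adj u v]]].

Lemma exists_inS S S' (P : pred (vertex G)) :
  S \subset S' -> [exists u in S, P u] -> [exists u in S', P u].
Proof.
move=> sSS' /exists_inP[u uS Pu]; apply/exists_inP; exists u => //.
exact: (subsetP sSS').
Qed.

Lemma hits_off_increasing a b U : increasing (hits_off a b U).
Proof.
move=> S S' sSS' /forall_inP H; apply/forall_inP => v /H/or3P[->|->|] //.
  by rewrite orbT.
by move/(exists_inS sSS') => ->; rewrite !orbT.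
Qed.

Lemma same_type_adj a b v : same_type a b -> v != a -> v != b -> adj v a = adj v b.
Proof.
move=> /eqP/setP/(_ v); rewrite !inE => + va vb.
by rewrite va vb /= !(@adj_sym G v).
Qed.

Lemma same_type_sym a b : same_type a b = same_type b a.
Proof. exact: eq_sym. Qed.

Lemma same_type_trans a b c : same_type a c -> same_type b c -> same_type a b.
Proof.
move=> ac bc; have [->|ab] := eqVneq a b; first exact: eqxx.
have [->|ca] := eqVneq a c; first by rewrite same_type_sym.
have [->|cb] := eqVneq b c; first by [].
apply/eqP/setP => v; rewrite !inE.
have [->|va] := eqVneq v a; first by rewrite adj_irr andbF.
have [->|vb] := eqVneq v b; first by rewrite adj_irr.
rewrite /= !(@adj_sym G _ v).
have [->|vc] := eqVneq v c; last by rewrite (same_type_adj ac) ?(same_type_adj bc).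
(* At [v = c], both adjacencies equal the adjacency of [a] and [b]. *)
rewrite (adj_sym c a) (adj_sym c b) -(same_type_adj bc ab ca).
by rewrite -(same_type_adj ac _ cb) 1?eq_sym // adj_sym.
Qed.

(** Dominator's half of the pairing: owning [a] dominates all neighbours of [a] and of [b], since a
    neighbour of [b] is [a] itself or a neighbour of [a]. *)
Lemma pair_hits a b U S : same_type a b -> a \in U -> b \in U ->
  hits_off a b U S -> hits U (a |: S).
Proof.
move=> ab aU bU /forall_inP Z; apply/forall_inP => v /Z /or3P[va|vb|].
- by apply/exists_inP; exists a; rewrite ?setU11 // adj_sym va orbT.
- apply/exists_inP; exists a; rewrite ?setU11 //.
  have [//|av] := eqVneq a v; rewrite adj_sym (same_type_adj ab) //= eq_sym //.
  by apply: contraTneq vb => ->; rewrite adj_irr.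
exact/exists_inS/subsetUr.
Qed.

(** Staller's half, contraposed: she owns [a] and [S], and if Dominator nevertheless hits everything
    with the rest, then [b] is dispensable to Dominator in the reduced goal. *)
Lemma hits_pair a b U F S : same_type a b -> a \in U -> b \in U -> a != b ->
    F = U :\ a :\ b ->
  hits U (U :\: (a |: S)) -> hits_off a b U (F :\: S).
Proof.
move=> ab aU bU neab -> /forall_inP H; apply/forall_inP => v vU.
case va : (adj v a) => //=; case vb : (adj v b) => //=.
(* Since [b] could dominate itself, for [v = b] the vertex dominating [a] is used instead. Here [b]
   is not adjacent to [a], and a neighbour of [a] other than [b] is a neighbour of [b]. *)
pose w := if v == b then a else v.
have /exists_inP[u] : [exists u in U :\: (a |: S), (u == w) || adj u w].
  by apply: H; rewrite /w; case: ifP.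
rewrite !inE negb_or => /andP[/andP[ua uS] uU] uw.
apply/exists_inP; exists u; rewrite ?inE ?ua ?uS ?uU ?andbT.
  apply: contraTneq uw => ->; rewrite /w.
  case: (eqVneq v b) => [E|nevb]; first by rewrite eq_sym (negPf neab) -E va.
  by rewrite eq_sym (negPf nevb) adj_sym vb.
move: uw; rewrite /w; case: (eqVneq v b) => // ->; rewrite (negPf ua) /= => uA.
have [//|ub] := eqVneq u b.
by rewrite -(same_type_adj ab).
Qed.

(** Both players can pair [a] with [b]: Dominator's pairing gives one implication, and Staller's,
    applied to the dual game, gives the other. *)
Lemma win_twins (first : bool) a b U : same_type a b -> a \in U -> b \in U -> a != b ->
  win (hits U) first set0 U = win (hits_off a b U) first set0 (U :\ a :\ b).
Proof.
move=> ab aU bU neab; set F := U :\ a :\ b.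
have UE : U = a |: (b |: F) by rewrite !setD1K // !inE eq_sym neab.
have aF : a \notin F by rewrite !inE eqxx andbF.
have bF : b \notin F by rewrite !inE eqxx.
have ba : same_type b a by rewrite same_type_sym.
have swapZ S : hits_off a b U S = hits_off b a U S.
  by apply: eq_forallb => v; rewrite orbCA.
apply/idP/idP; last first.
  move=> wF; rewrite [X in win _ _ _ X]UE; apply: win_pairing wF => // S _.
  rewrite set0U => ZS.
  by rewrite (@pair_hits a b) // (@pair_hits b a) // -swapZ.
have dual W (V : {set vertex G}) : win (fun S => ~~ W (V :\: S)) (~~ first) set0 V =
    ~~ win W first set0 V.
  by apply: win_dual => S _; rewrite !set0U.
apply: contraLR; rewrite -!dual => wF.
rewrite [X in win _ _ _ X]UE; apply: win_pairing wF => // S _.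
rewrite !set0U => nZ; apply/andP; split; apply: contra nZ => H.
  exact: hits_pair H.
by rewrite swapZ; apply: hits_pair H => //; [rewrite eq_sym | rewrite /F setD1C].
Qed.

(** After [win_twins] the two boards differ only by [c]. *)
Lemma win_delete (first : bool) a b c U :
    same_type a c -> same_type b c -> a \in U -> b \in U -> c \in U ->
    a != b -> a != c -> b != c ->
  win (hits (U :\ c)) first set0 (U :\ c) = win (hits U) first set0 U.
Proof.
move=> ac bc aU bU cU neab neac nebc.
have ab := same_type_trans ac bc.
rewrite !(@win_twins first a b) ?inE ?neac ?nebc //.
set F := U :\ c :\ a :\ b.
have UE : U :\ a :\ b = c |: F.
  by rewrite /F (setD1C U c a) (setD1C _ c b) setD1K // !inE cU ![c == _]eq_sym neac nebc.
have cF : c \notin F by rewrite !inE eqxx !andbF.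
have nadj v : v != c -> ~~ adj v a -> ~~ adj v b -> ~~ adj c v.
  move=> vc va vb; rewrite adj_sym.
  have [E|neva] := eqVneq v a; last by rewrite -(same_type_adj ac).
  by rewrite -(same_type_adj bc) //; rewrite E.
(* Claiming [c] is worthless: a neighbour of [c] is adjacent to [a] or [b], hence already
   forgotten. *)
have Zc S : hits_off a b (U :\ c) (c |: S) = hits_off a b (U :\ c) S.
  apply/idP/idP; last exact/hits_off_increasing/subsetUr.
  move=> /forall_inP Z; apply/forall_inP => v vU; case/or3P: (Z v vU) => [->|->|].
  - by [].
  - by rewrite orbT.
  case va : (adj v a) => //; case vb : (adj v b) => //=.
  case/exists_inP => u; rewrite !inE => /predU1P[->|uS uv].
    move: vU; rewrite !inE => /andP[vc _]; rewrite eq_sym (negPf vc) /=.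
    by rewrite (negPf (nadj _ vc _ _)) ?va ?vb.
  by apply/exists_inP; exists u.
rewrite UE; apply/idP/idP => wF; last first.
  apply: (@win_drop_dummy _ _ _ _ _ c) => //; first exact: hits_off_increasing.
  apply: win_mono wF => S _ /forall_inP Z; apply/forall_inP => v.
  by rewrite inE => /andP[_ /Z].
apply: win_add_dummy => //; first exact: hits_off_increasing.
apply: win_mono wF => S SF; rewrite !set0U => /forall_inP Z; apply/forall_inP => v vU.
have [->|vc] := eqVneq v c; last by apply: Z; rewrite !inE vc.
case ca : (adj c a) => //=; case cb : (adj c b) => //=.
(* The condition at [c] follows from the one at [a]: with [c] adjacent to neither [a] nor [b], these
   two are nonadjacent, so a neighbour of [a] is claimed, and it is a neighbour of [c]. *)
have := Z a; rewrite !inE neac aU adj_irr adj_sym => /(_ isT).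
have ba : adj b a = false.
  by rewrite (same_type_adj ac) // 1?eq_sym // adj_sym.
rewrite ba /= => /exists_inP[u uS].
have ua : u != a.
  by apply: contraTneq uS => ->; apply/negP => /(subsetP SF); rewrite !inE eqxx andbF.
have uc : u != c.
  by apply: contraTneq uS => ->; apply/negP => /(subsetP SF); rewrite (negPf cF).
rewrite (negPf ua) (same_type_adj ac) //= => uc'.
by apply/exists_inP; exists u; rewrite ?uc' ?orbT.
Qed.

(** Counting smaller twins avoids computing a type partition, and is what the program does. *)
Definition kept v : bool := #|[set u : vertex G | (u < v) && same_type u v]| < 2.

Lemma win_kept (first : bool) :
  win (hits [set v | kept v]) first set0 [set v | kept v] =
  win (hits setT) first set0 setT.
Proof.
(* Discarded vertices are deleted in decreasing order of index, so the two smaller twins of the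
   vertex being deleted are still present. *)
pose U k : {set vertex G} := [set v | kept v || (v < k)].
have U0 : U 0 = [set v | kept v] by apply/setP => v; rewrite !inE orbF.
have UT : U (order G) = setT by apply/setP => v; rewrite !inE ltn_ord orbT.
suff H k : k <= order G ->
    win (hits (U 0)) first set0 (U 0) = win (hits (U k)) first set0 (U k).
  by rewrite -U0 -UT; exact: H.
elim: k => // k IH ltk.
rewrite IH ?(ltnW ltk) //; pose c : vertex G := Ordinal ltk.
have Uc : U k.+1 :\ c = U k :\ c.
  apply/setP => v; rewrite !inE ltnS leq_eqVlt.
  have [//|vc] := eqVneq v c; suff -> : (v == k :> nat) = false by [].
  exact: negPf vc.
have [kc|nkc] := boolP (kept c).
  suff -> : U k.+1 = U k by [].
  apply/setP => v; move/setP/(_ v): Uc; rewrite !inE.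
  by have [->|] := eqVneq v c; rewrite ?kc.
have -> : U k = U k.+1 :\ c.
  rewrite Uc; apply/setP => v; rewrite !inE; case: eqVneq => // ->.
  by rewrite (negPf nkc) /= ltnn.
move: nkc; rewrite -leqNgt => /card_gt1P[a [b [+ + neab]]].
rewrite !inE => /andP[ltac ac] /andP[ltbc bc].
have ltU v : v < c -> (v \in U k.+1) && (v != c).
  move=> ltvc; rewrite !inE ltnS (ltnW ltvc) orbT /=.
  by apply: contraTneq ltvc => ->; rewrite ltnn.
have /andP[aU neac] := ltU a ltac; have /andP[bU nebc] := ltU b ltbc.
by apply: (@win_delete _ a b c) => //; rewrite inE /= ltnS leqnn orbT.
Qed.

End Twins.

(** * Induced subgraphs with renumbered vertices *)

Section Induced.

Variables (G : graph) (K : seq (vertex G)).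

Definition induced_adj : rel 'I_(size K) :=
  fun i j => adj (tnth (in_tuple K) i) (tnth (in_tuple K) j).

Lemma induced_adj_sym : symmetric induced_adj.
Proof. by move=> i j; apply: adj_sym. Qed.

Lemma induced_adj_irr : irreflexive induced_adj.
Proof. by move=> i; apply: adj_irr. Qed.

Definition induced : graph := Graph induced_adj_sym induced_adj_irr.

Lemma win_induced (first : bool) : uniq K ->
  win (@dominating induced) first set0 setT =
  win (hits [set v in K]) first set0 [set v in K].
Proof.
move=> uK; pose f (i : vertex induced) := tnth (in_tuple K) i.
have injf : injective f by move=> i j; apply/tuple_uniqP.
have <- : f @: setT = [set v in K].
  apply/setP => v; rewrite inE; apply/imsetP/idP => [[i _ ->]|]; first exact: mem_tnth.
  by move/(tnthP (in_tuple K)) => [i ->]; exists i.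
rewrite -[set0 in RHS](imset0 f) win_imset //.
have domE (S : {set vertex induced}) : dominating S = hits (f @: setT) (f @: S).
  apply/forallP/forall_inP => [H _ /imsetP[i _ ->]|H i].
    case/orP: (H i) => [iS|/exists_inP[j jS ji]]; apply/exists_inP.
      by exists (f i); rewrite ?eqxx // imset_f.
    by exists (f j); rewrite ?imset_f //; apply/orP; right.
  have /exists_inP[_ /imsetP[j jS ->]] := H (f i) (imset_f _ (in_setT _)).
  rewrite (inj_eq injf) => /predU1P[<-|ji]; first by rewrite jS.
  by apply/orP; right; apply/exists_inP; exists j.
by apply/idP/idP; apply: win_mono => S _; rewrite !set0U domE.
Qed.

End Induced.

(** * The kernel: equivalence and size *)

Definition kept_seq (G : graph) : seq (vertex G) := [seq v <- enum 'I_(order G) | kept v].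

Definition kernel (I : instance) : instance :=
  Instance (induced (kept_seq (igraph I))) (ifirst I).

Lemma kernel_equivalent I : equivalent_instances I (kernel I).
Proof.
case: I => G first X; rewrite /kernel /=.
have domE (b : bool) : win (@dominating (induced (kept_seq G))) b set0 setT =
    win (@dominating G) b set0 setT.
  rewrite win_induced; last exact/filter_uniq/enum_uniq.
  have -> : [set v in kept_seq G] = [set v | kept v].
    by apply/setP => v; rewrite !inE mem_filter mem_enum andbT.
  rewrite win_kept.
  suff E (S : {set vertex G}) : hits setT S = dominating S.
    by apply/idP/idP; apply: win_mono => S _; rewrite !set0U E.
  apply/forall_inP/forallP => H v; last first.
    move=> _; case/orP: (H v) => [vS|/exists_inP[u uS uv]]; apply/exists_inP.
      by exists v; rewrite ?eqxx.
    by exists u; rewrite ?uv ?orbT.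
  have /exists_inP[u uS /predU1P[<-|uv]] := H v (in_setT v); first by rewrite uS.
  by apply/orP; right; apply/exists_inP; exists u.
(* By determinacy, Staller's claim reduces to Dominator's. *)
have stE (H : graph) (b' : bool) : win (@goal H Staller) (~~ b') set0 setT =
    ~~ win (@dominating H) b' set0 setT.
  by apply: win_dual => S _; rewrite !set0U setTD.
rewrite !has_winning_strategyP; case: X => /=; first by rewrite domE.
by rewrite -[mine first Staller 0]negbK !stE domE.
Qed.

(** A class of a minimum type partition holds at most two kept vertices, whence the constant 2. *)
Lemma kernel_linear I :
  order (igraph (kernel I)) <= 2 * neighborhood_diversity (igraph I).
Proof.
case: I => G first /=; rewrite /neighborhood_diversity.
case: ex_minnP => w /existsP[P /andP[/andP[partP /forall_inP sameP] /eqP <-]] _.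
have -> : size (kept_seq G) = #|[set v : vertex G | kept v]|.
  rewrite -(card_uniqP (filter_uniq _ (enum_uniq _))); apply: eq_card => v.
  by rewrite !inE mem_filter mem_enum andbT.
rewrite -sum1_card (partition_big (pblock P) [in P]) /=; last first.
  by move=> v _; apply: pblock_mem; rewrite (cover_partition partP).
rewrite mulnC -sum_nat_const; apply: leq_sum => A AP.
rewrite sum1dep_card leqNgt; apply/negP; set E := [set _ | _] => gt2.
have inA v : v \in E -> v \in A.
  rewrite inE => /andP[_ /eqP <-]; rewrite mem_pblock.
  by rewrite (cover_partition partP).
have /card_gt0P[x xE] : 0 < #|E| by apply: leq_trans gt2.
(* Among three kept vertices of one class, the one of largest index has two smaller twins, a
   contradiction. *)
case: (@arg_maxnP _ x [in E] (@nat_of_ord _) xE) => z /= zE maxz.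
have : kept z by move: (zE); rewrite !in_set => /andP[].
rewrite /kept ltnNge => /negP[]; rewrite -ltnS; apply: leq_trans gt2 _.
rewrite (cardsD1 z E) zE ltnS subset_leq_card //.
apply/subsetP => v; rewrite in_setD1 => /andP[vz vE]; rewrite inE ltn_neqAle vz maxz //=.
by have /forall_inP/(_ v (inA v vE))/forall_inP/(_ z (inA z zE)) := sameP A AP.
Qed.

(** * Computing the kernel *)

(** A total-correctness triple in which [T] bounds the running time. *)
Definition runs (c : cmd) (s : state) (T : nat) (Q : state -> Prop) : Prop :=
  exists t s', [/\ exec c s t s', t <= T & Q s'].

Lemma runs_le T T' c s Q : runs c s T Q -> T <= T' -> runs c s T' Q.
Proof.
by move=> [t [s' [H tT q]]] TT'; exists t, s'; split=> //; apply: leq_trans TT'.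
Qed.

Lemma runs_skip T s (Q : state -> Prop) : Q s -> runs Skip s T.+1 Q.
Proof. by move=> q; exists 1, s; split=> //; constructor. Qed.

Lemma runs_assign T r e s (Q : state -> Prop) :
  Q (State (update (regs s) r (eval s e)) (mem s)) -> runs (Assign r e) s T.+1 Q.
Proof. by move=> q; eexists 1, _; split; [constructor|..]. Qed.

Lemma runs_store T a e s (Q : state -> Prop) :
  Q (State (regs s) (update (mem s) (eval s a) (eval s e))) ->
  runs (Store a e) s T.+1 Q.
Proof. by move=> q; eexists 1, _; split; [constructor|..]. Qed.

Lemma runs_seq T1 T2 c1 c2 s Q :
  runs c1 s T1 (fun s1 => runs c2 s1 T2 Q) -> runs (Seq c1 c2) s (T1 + T2) Q.
Proof.
move=> [t1 [s1 [H1 tT1 [t2 [s2 [H2 tT2 q]]]]]]; exists (t1 + t2), s2.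
by split=> //; [apply: ExecSeq H2 | apply: leq_add].
Qed.

Lemma runs_assign_seq T r e c s Q :
  runs c (State (update (regs s) r (eval s e)) (mem s)) T Q ->
  runs (Seq (Assign r e) c) s T.+1 Q.
Proof. by move=> q; apply: (@runs_seq 1 T); apply: runs_assign. Qed.

Lemma runs_if T e c1 c2 s Q :
    (eval s e != 0 -> runs c1 s T Q) -> (eval s e = 0 -> runs c2 s T Q) ->
  runs (If e c1 c2) s T.+1 Q.
Proof.
move=> H1 H2; case: (eqVneq (eval s e) 0) => [e0|e0].
  have [t [s' [H tT q]]] := H2 e0; exists t.+1, s'; split=> //.
  by apply: ExecIfFalse H; rewrite e0.
by have [t [s' [H tT q]]] := H1 e0; exists t.+1, s'; split=> //; apply: ExecIfTrue H.
Qed.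

(** The invariant is indexed by the number of completed iterations. Each iteration pays one extra
    unit for its test, and the failing test pays the last one. *)
Lemma runs_while (P : nat -> state -> Prop) N T e c s :
    (forall i s', i < N -> P i s' -> eval s' e != 0 /\ runs c s' T (P i.+1)) ->
    (forall s', P N s' -> eval s' e = 0) ->
  P 0 s -> runs (While e c) s (N * T.+1).+1 (P N).
Proof.
move=> step stop; suff H k i : N - i = k -> i <= N -> forall s, P i s ->
    runs (While e c) s (k * T.+1).+1 (P N) by apply: H; rewrite ?subn0.
elim: k => [|k IH] in i * => Ek iN {}s Pi.
  have Ei : i = N by lia.
  exists 1, s; split=> //; last by rewrite -Ei.
  by apply: ExecWhileFalse; rewrite (stop s) // -Ei.
have [|e0 [t1 [s1 [H1 tT1 Pi1]]]] := step i s _ Pi; first by lia.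
have [||t2 [s2 [H2 tT2 PN]]] := IH i.+1 _ _ s1 Pi1; try lia.
by exists (t1 + t2).+1, s2; split=> //; [apply: ExecWhileTrue H2 | lia].
Qed.

Lemma updateE f a v : update f a v a = v.
Proof. by rewrite /update eqxx. Qed.

Lemma update_lt f a v r : r < a -> update f a v r = f r.
Proof. by rewrite /update; case: eqP => // ->; rewrite ltnn. Qed.

(** With truncated subtraction, this sum is the distance of the two values; it serves as a test of
    inequality. *)
Definition diff (e1 e2 : expr) : expr := Plus (Minus e1 e2) (Minus e2 e1).

Lemma eval_diff s e1 e2 : (eval s (diff e1 e2) == 0) = (eval s e1 == eval s e2).
Proof. by rewrite /=; lia. Qed.

Definition increment (r : nat) (e : expr) : cmd := Assign r (Plus (Reg r) e).

(* Registers: 0 holds the order n, 1 the address 2 + n^2 of the table of flags,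
   2 a vertex v, 3 the address of row v, 4 the number of kept vertices;
   registers from 5 on are scratch. *)

Definition prologue : cmd :=
  Seq (Assign 0 (Read (Lit 0)))
  (Seq (Assign 1 (Lit 2))
  (Seq (Assign 2 (Lit 0))
  (While (Minus (Reg 0) (Reg 2)) (Seq (increment 1 (Reg 0)) (increment 2 (Lit 1)))))).

(** Register 6 holds the other vertex, 7 the address of its row, 8 the verdict and 9 the current
    column. *)
Definition test_twins : cmd :=
  Seq (Assign 8 (Lit 1))
  (Seq (Assign 9 (Lit 0))
  (While (Minus (Reg 0) (Reg 9))
    (Seq
      (If (diff (Reg 9) (Reg 6))
        (If (diff (Reg 9) (Reg 2))
          (If (diff (Read (Plus (Reg 7) (Reg 9))) (Read (Plus (Reg 3) (Reg 9))))
            (Assign 8 (Lit 0)) Skip) Skip) Skip)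
      (increment 9 (Lit 1))))).

Definition count_twins : cmd :=
  Seq (Assign 5 (Lit 0))
  (Seq (Assign 6 (Lit 0))
  (Seq (Assign 7 (Lit 2))
  (While (Minus (Reg 2) (Reg 6))
    (Seq test_twins
    (Seq (increment 5 (Reg 8))
    (Seq (increment 6 (Lit 1))
         (increment 7 (Reg 0)))))))).

Definition flag_vertices : cmd :=
  Seq (Assign 2 (Lit 0))
  (Seq (Assign 3 (Lit 2))
  (Seq (Assign 4 (Lit 0))
  (While (Minus (Reg 0) (Reg 2))
    (Seq count_twins
    (Seq (Store (Plus (Reg 1) (Reg 2)) (Minus (Lit 2) (Reg 5)))
    (Seq (If (Minus (Lit 2) (Reg 5)) (increment 4 (Lit 1)) Skip)
    (Seq (increment 2 (Lit 1))
         (increment 3 (Reg 0))))))))).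

(** Register 5 holds the next address to write, 6 the current column. *)
Definition copy_row : cmd :=
  Seq (Assign 6 (Lit 0))
  (While (Minus (Reg 0) (Reg 6))
    (Seq
      (If (Read (Plus (Reg 1) (Reg 6)))
        (Seq (Store (Reg 5) (Read (Plus (Reg 3) (Reg 6)))) (increment 5 (Lit 1)))
        Skip)
      (increment 6 (Lit 1)))).

Definition copy_rows : cmd :=
  Seq (Assign 2 (Lit 0))
  (Seq (Assign 3 (Lit 2))
  (Seq (Assign 5 (Lit 2))
  (While (Minus (Reg 0) (Reg 2))
    (Seq (If (Read (Plus (Reg 1) (Reg 2))) copy_row Skip)
    (Seq (increment 2 (Lit 1))
         (increment 3 (Reg 0))))))).

Definition kernel_cmd : cmd :=
  Seq prologue (Seq flag_vertices (Seq copy_rows (Store (Lit 0) (Reg 4)))).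

(** * Correctness and running time of the program *)

Lemma iotaSr i : iota 0 i.+1 = rcons (iota 0 i) i.
Proof. by rewrite -cats1 -addn1 iotaD. Qed.

Section Kernelization.

Variables (n : nat) (m0 : nat -> nat).
Hypothesis m0E : m0 0 = n.

Definition entry u v := m0 (2 + u * n + v).

Definition twins u v : bool :=
  all (fun w => [|| w == u, w == v | entry u w == entry v w]) (iota 0 n).

(** By truncation, nonzero exactly when fewer than two smaller twins exist. *)
Definition flag v := 2 - count (fun u => twins u v) (iota 0 v).

Definition kept_below v := [seq u <- iota 0 v | flag u != 0].

Lemma kept_belowS v : kept_below v.+1 =
  if flag v != 0 then rcons (kept_below v) v else kept_below v.
Proof. by rewrite /kept_below iotaSr filter_rcons. Qed.

(** The square of [n] is obtained by adding [n] repeatedly, as multiplication is not primitive. *)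
Lemma prologueP s : mem s = m0 ->
  runs prologue s (3 * n + 4)
    (fun s' => [/\ mem s' = m0, regs s' 0 = n & regs s' 1 = 2 + n * n]).
Proof.
move=> mE; rewrite addnC; do 3!apply: runs_assign_seq.
pose P i s' := [/\ mem s' = m0, regs s' 0 = n, regs s' 1 = 2 + i * n & regs s' 2 = i].
apply: (@runs_le (n * 3).+1); last by lia.
set s1 := State _ _.
suff [t [s' [ex tT [? ? ? ?]]]] : runs (While (Minus (Reg 0) (Reg 2))
    (Seq (increment 1 (Reg 0)) (increment 2 (Lit 1)))) s1 (n * 3).+1 (P n).
  by exists t, s'; split.
apply: runs_while => [i s' lti [m' r0 r1 r2]|s' [m' r0 r1 r2]|]; last 2 first.
- by rewrite /= r0 r2 subnn.
- by rewrite /P /update /= mE.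
rewrite /= r0 r2; split; first by lia.
by apply: runs_assign_seq; apply: runs_assign; split; rewrite /update /= ?r0 ?r1 ?r2 //; lia.
Qed.

(** Memory is prescribed only on the header and the matrix, because flags of earlier vertices may
    already be stored above. *)
Lemma test_twinsP u v s : u < n -> v < n ->
    regs s 0 = n -> regs s 2 = v -> regs s 3 = 2 + v * n ->
    regs s 6 = u -> regs s 7 = 2 + u * n ->
    (forall a, a < 2 + n * n -> mem s a = m0 a) ->
  runs test_twins s (6 * n + 3)
    (fun s' => [/\ mem s' = mem s, forall r, r < 8 -> regs s' r = regs s r &
       regs s' 8 = twins u v]).
Proof.
move=> ltu ltv r0 r2 r3 r6 r7 mE.
pose P i s' := [/\ mem s' = mem s, forall r, r < 8 -> regs s' r = regs s r,
  regs s' 8 = all (fun w => [|| w == u, w == v | entry u w == entry v w]) (iota 0 i)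
  & regs s' 9 = i].
rewrite addnC; do 2!apply: runs_assign_seq.
set s1 := State _ _; apply: (@runs_le (n * 6).+1); last by lia.
suff [t [s' [ex tT [? ? ? ?]]]] : runs (While (Minus (Reg 0) (Reg 9))
    (Seq
      (If (diff (Reg 9) (Reg 6))
        (If (diff (Reg 9) (Reg 2))
          (If (diff (Read (Plus (Reg 7) (Reg 9))) (Read (Plus (Reg 3) (Reg 9))))
            (Assign 8 (Lit 0)) Skip) Skip) Skip)
      (increment 9 (Lit 1)))) s1 (n * 6).+1 (P n).
  by exists t, s'; split.
apply: runs_while => [i s' lti [m' r' r8 r9]|s' [m' r' r8 r9]|]; last 2 first.
- by rewrite /= r' // r0 r9 subnn.
- by split=> // r r8; rewrite /= !update_lt //; lia.
rewrite /= r' // r0 r9; split; first by lia.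
have rows : forall w, w < n -> (forall s2, mem s2 = mem s -> forall k,
  k < n -> forall r, regs s2 r = 2 + k * n -> regs s2 9 = w ->
  eval s2 (Read (Plus (Reg r) (Reg 9))) = entry k w).
  move=> w ltw s2 E2 k ltk r Er E9; rewrite /= Er E9 E2 mE //.
  by nia.
rewrite -[5]/(4 + 1); apply: runs_seq.
have r8' : all (fun w => [|| w == u, w == v | entry u w == entry v w]) (iota 0 i.+1)
  = (regs s' 8 != 0) && [|| i == u, i == v | entry u i == entry v i].
  by rewrite iotaSr all_rcons r8 andbC; case: (all _ _).
have e6 : (eval s' (diff (Reg 9) (Reg 6)) == 0) = (i == u).
  by rewrite eval_diff /= r9 r' // r6.
have e2 : (eval s' (diff (Reg 9) (Reg 2)) == 0) = (i == v).
  by rewrite eval_diff /= r9 r' // r2.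
have eE : (eval s' (diff (Read (Plus (Reg 7) (Reg 9)))
                         (Read (Plus (Reg 3) (Reg 9)))) == 0)
    = (entry u i == entry v i).
  by rewrite eval_diff (rows i lti s' m' u) ?(rows i lti s' m' v) // r' // ?r7 ?r3.
(* Common end of the branches that leave the verdict unchanged. *)
have keep : [|| i == u, i == v | entry u i == entry v i] ->
    runs (increment 9 (Lit 1)) s' 1 (P i.+1).
  move=> ok; apply: runs_assign; split=> //.
  - by move=> r ltr; rewrite /= update_lt ?r' //; lia.
  - by rewrite r8' ok andbT /= update_lt // r8; case: (all _ _).
  - by rewrite /= updateE r9 addn1.
apply: runs_if => [|/eqP]; rewrite e6 => iu; last first.
  by apply: runs_skip; apply: keep; rewrite iu.
apply: runs_if => [|/eqP]; rewrite e2 => iv; last first.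
  by apply: runs_skip; apply: keep; rewrite iv orbT.
apply: runs_if => [|/eqP]; rewrite eE => iE; last first.
  by apply: runs_skip; apply: keep; rewrite iE !orbT.
apply: runs_assign; apply: runs_assign; split=> //.
- by move=> r ltr; rewrite /= !update_lt ?r' //; lia.
- by rewrite r8' /= update_lt // updateE (negPf iu) (negPf iv) (negPf iE) andbF.
- by rewrite /= updateE /update /= r9 addn1.
Qed.

Lemma count_twinsP v s : v < n ->
    regs s 0 = n -> regs s 2 = v -> regs s 3 = 2 + v * n ->
    (forall a, a < 2 + n * n -> mem s a = m0 a) ->
  runs count_twins s (n * (6 * n + 7) + 4)
    (fun s' => [/\ mem s' = mem s, forall r, r < 5 -> regs s' r = regs s r &
       2 - regs s' 5 = flag v]).
Proof.
move=> ltv r0 r2 r3 mE.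
pose P i s' := [/\ mem s' = mem s, forall r, r < 5 -> regs s' r = regs s r,
  regs s' 5 = count (fun u => twins u v) (iota 0 i),
  regs s' 6 = i & regs s' 7 = 2 + i * n].
rewrite addnC; do 3!apply: runs_assign_seq.
set s1 := State _ _; apply: (@runs_le (v * (6 * n + 7)).+1); last by nia.
suff [t [s' [ex tT [? ? r5 ? ?]]]] : runs (While (Minus (Reg 2) (Reg 6))
    (Seq test_twins
    (Seq (increment 5 (Reg 8))
    (Seq (increment 6 (Lit 1))
         (increment 7 (Reg 0)))))) s1 (v * (6 * n + 7)).+1 (P v).
  by exists t, s'; split=> //; split=> //; rewrite r5.
rewrite addnS; apply: runs_while => [i s' lti [m' r' r5 r6 r7]
  |s' [m' r' r5 r6 r7]|]; last 2 first.
- by rewrite /= r' // r2 r6 subnn.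
- by split=> // r r5; rewrite /= !update_lt //; lia.
rewrite /= r' // r2 r6; split; first by lia.
apply: (@runs_le ((6 * n + 3) + 3)); last by lia.
apply: runs_seq.
have [|t [s2 [ex tT [m2 f2 r8]]]] := test_twinsP (ltn_trans lti ltv) ltv
  (etrans (r' 0 isT) r0) (etrans (r' 2 isT) r2) (etrans (r' 3 isT) r3) r6 r7.
  by rewrite m'.
exists t, s2; split=> //.
apply: runs_assign_seq; apply: runs_assign_seq; apply: runs_assign.
split; first by rewrite /= m2.
- by move=> r ltr; rewrite /= !update_lt ?f2 ?r' //; lia.
- by rewrite iotaSr -cats1 count_cat /update /= r8 f2 // r5 addn0.
- by rewrite /update /= f2 // r6 addn1.
by rewrite /update /= !f2 // (r' 0 isT) r7 r0 mulSn; lia.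
Qed.

(** The memory once the first [v] flags are stored just after the matrix. *)
Definition flagged v a :=
  if (2 + n * n <= a) && (a < 2 + n * n + v) then flag (a - (2 + n * n)) else m0 a.

Lemma flag_verticesP s : mem s = m0 -> regs s 0 = n -> regs s 1 = 2 + n * n ->
  runs flag_vertices s (n * (n * (6 * n + 7) + 10) + 4)
    (fun s' => [/\ mem s' =1 flagged n, regs s' 0 = n, regs s' 1 = 2 + n * n
      & regs s' 4 = size (kept_below n)]).
Proof.
move=> mE r0 r1.
pose P i s' := [/\ mem s' =1 flagged i, regs s' 0 = n /\ regs s' 1 = 2 + n * n,
  regs s' 2 = i, regs s' 3 = 2 + i * n & regs s' 4 = size (kept_below i)].
rewrite addnC; do 3!apply: runs_assign_seq.
set s1 := State _ _; apply: (@runs_le (n * (n * (6 * n + 7) + 9).+1).+1); last by lia.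
have P0 : P 0 s1.
  by split=> // a; rewrite /s1 /= mE /flagged; case: ifP => //; lia.
suff [t [s' [ex tT [? [? ?] ? ? ?]]]] : runs (While (Minus (Reg 0) (Reg 2))
    (Seq count_twins
    (Seq (Store (Plus (Reg 1) (Reg 2)) (Minus (Lit 2) (Reg 5)))
    (Seq (If (Minus (Lit 2) (Reg 5)) (increment 4 (Lit 1)) Skip)
    (Seq (increment 2 (Lit 1))
         (increment 3 (Reg 0))))))) s1 (n * (n * (6 * n + 7) + 9).+1).+1 (P n).
  by exists t, s'; split.
apply: runs_while => [i s' lti [m' [r0' r1'] r2 r3 r4]
  |s' [m' [r0' r1'] r2 r3 r4]|//]; last first.
  by rewrite /= r0' r2 subnn.
rewrite /= r0' r2; split; first by lia.
apply: (@runs_le ((n * (6 * n + 7) + 4) + (1 + (2 + 2)))); last by lia.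
apply: runs_seq; have [|t [s2 [ex tT [m2 f2 r5]]]] := count_twinsP lti r0' r2 r3.
  by move=> a lta; rewrite m' /flagged leqNgt lta.
exists t, s2; split=> //.
apply: runs_seq; apply: runs_store.
set s3 := State _ _.
have P3 : [/\ mem s3 =1 flagged i.+1, regs s3 0 = n /\ regs s3 1 = 2 + n * n,
    regs s3 2 = i, regs s3 3 = 2 + i * n & regs s3 4 = size (kept_below i)].
  rewrite /s3 /= r5 !f2 //; split=> // a.
  rewrite /update r1' r2 m2 m' /flagged.
  case: eqP => [->|ne]; first by rewrite leq_addr addKn ltn_add2l ltnSn.
  by have -> : (a < 2 + n * n + i.+1) = (a < 2 + n * n + i) by lia.
have r53 : eval s3 (Minus (Lit 2) (Reg 5)) = flag i by [].
move: s3 P3 r53 => {ex m2 f2 r5 r2 r3 r4 m' r0' r1'} s3 [m3 [r0' r1'] r2 r3 r4] r5.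
apply: runs_seq; apply: runs_if; rewrite r5 => fi.
  apply: runs_assign; apply: runs_assign_seq; apply: runs_assign.
  split; rewrite ?kept_belowS ?fi ?size_rcons /update /= ?r0' ?r1' ?r2 ?r3 ?r4 //;
  rewrite ?mulSn ?addn1 //; lia.
apply: runs_skip; apply: runs_assign_seq; apply: runs_assign.
split; rewrite ?kept_belowS ?fi /update /= ?r0' ?r1' ?r2 ?r3 ?r4 //;
  rewrite ?mulSn ?addn1 //; lia.
Qed.

(** The memory during the compaction: [out] overwrites the matrix from address 2 on. *)
Definition written out a :=
  if (2 <= a) && (a < 2 + size out) then nth 0 out (a - 2) else flagged n a.

Lemma written_rcons out x a :
  update (written out) (2 + size out) x a = written (rcons out x) a.
Proof.
rewrite /update /written size_rcons nth_rcons.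
case: eqP => [->|ne]; first by rewrite leq_addr addKn ltn_add2l ltnSn ltnn eqxx.
have -> : (a < 2 + (size out).+1) = (a < 2 + size out) by lia.
by case: ifP => // /andP[a2 lta]; rewrite (_ : a - 2 < size out = true) //; lia.
Qed.

Lemma size_kept_below v : size (kept_below v) <= v.
Proof. by rewrite size_filter -{2}(size_iota 0 v) count_size. Qed.

Definition rows v := [seq entry x y | x <- kept_below v, y <- kept_below n].

Lemma size_rows v : size (rows v) <= v * n.
Proof. by rewrite size_allpairs leq_mul ?size_kept_below. Qed.

(** The output never exceeds the [n * n] cells of the matrix, so the flags stay readable. *)
Lemma written_flag v out : v < n -> size out <= n * n ->
  written out (2 + n * n + v) = flag v.
Proof.
move=> ltv szo; rewrite /written ifF; last by lia.
by rewrite /flagged leq_addr ltn_add2l ltv addKn.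
Qed.

(* The rows are compacted in place: the output never overtakes the input, since
   at most [v * n + u] entries have been written when entry [(v, u)] is read. *)
Lemma written_entry v u out : v < n -> u < n -> size out <= v * n + u ->
  written out (2 + v * n + u) = entry v u.
Proof.
move=> ltv ltu szo; rewrite /written ifF; last by lia.
by rewrite /flagged ifF //; nia.
Qed.

Lemma copy_rowP v s : v < n -> regs s 0 = n -> regs s 1 = 2 + n * n ->
    regs s 3 = 2 + v * n -> regs s 5 = 2 + size (rows v) ->
    mem s =1 written (rows v) ->
  let out := rows v ++ [seq entry v y | y <- kept_below n] in
  runs copy_row s (5 * n + 2)
    (fun s' => [/\ mem s' =1 written out, forall r, r < 5 -> regs s' r = regs s r
      & regs s' 5 = 2 + size out]).
Proof.
move=> ltv r0 r1 r3 r5 mE /=.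
pose out i := rows v ++ [seq entry v y | y <- kept_below i].
pose P i s' := [/\ mem s' =1 written (out i), forall r, r < 5 -> regs s' r = regs s r,
  regs s' 5 = 2 + size (out i) & regs s' 6 = i].
rewrite addnC; apply: runs_assign_seq.
set s1 := State _ _; apply: (@runs_le (n * 5).+1); last by lia.
have P0 : P 0 s1.
  rewrite /P /out /kept_below cats0; split=> //= r ltr.
  by rewrite update_lt //; lia.
suff [t [s' [ex tT [? ? ? ?]]]] : runs (While (Minus (Reg 0) (Reg 6))
    (Seq
      (If (Read (Plus (Reg 1) (Reg 6)))
        (Seq (Store (Reg 5) (Read (Plus (Reg 3) (Reg 6)))) (increment 5 (Lit 1)))
        Skip)
      (increment 6 (Lit 1)))) s1 (n * 5).+1 (P n).
  by exists t, s'; split.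
apply: runs_while => [i s' lti [m' r' r5' r6]|s' [m' r' r5' r6]|//]; last first.
  by rewrite /= r' // r0 r6 subnn.
rewrite /= r' // r0 r6; split; first by lia.
(* This bound is what allows the entry in column [i] to be read before it is overwritten. *)
have szo : size (out i) <= v * n + i.
  by rewrite size_cat size_map leq_add ?size_rows ?size_kept_below.
have szn : size (out i) <= n * n by apply: leq_trans szo _; nia.
have outS : out i.+1 = if flag i != 0 then rcons (out i) (entry v i) else out i.
  by rewrite /out kept_belowS; case: ifP => // _; rewrite map_rcons -rcons_cat.
rewrite -[4]/(3 + 1); apply: runs_seq; apply: runs_if => /=;
  rewrite r' // r1 r6 m' written_flag // => fi.
  rewrite -[2]/(1 + 1); apply: runs_seq; apply: runs_store; do 2!apply: runs_assign.
  rewrite /= (r' 3 isT) r3 r5' r6 m' written_entry //.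
  split=> //=.
  - by move=> a; rewrite outS fi -written_rcons /update; case: eqP.
  - by move=> r ltr; rewrite !update_lt ?r' //; lia.
  - by rewrite /update /= outS fi size_rcons addn1 addnS.
  - by rewrite /update /= ?r6 addn1.
apply: runs_skip; apply: runs_assign; split=> //=.
- by move=> a; rewrite outS fi.
- by move=> r ltr; rewrite update_lt ?r' //; lia.
- by rewrite /update /= outS fi ?r5'.
- by rewrite /update /= ?r6 addn1.
Qed.

Lemma copy_rowsP s : regs s 0 = n -> regs s 1 = 2 + n * n ->
    mem s =1 flagged n ->
  runs copy_rows s (n * (5 * n + 6) + 4)
    (fun s' => mem s' =1 written (rows n) /\ regs s' 4 = regs s 4).
Proof.
move=> r0 r1 mE.
pose P i s' := [/\ mem s' =1 written (rows i),
  [/\ regs s' 0 = n, regs s' 1 = 2 + n * n & regs s' 4 = regs s 4],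
  regs s' 2 = i, regs s' 3 = 2 + i * n & regs s' 5 = 2 + size (rows i)].
rewrite addnC; do 3!apply: runs_assign_seq.
set s1 := State _ _; apply: (@runs_le (n * (5 * n + 5).+1).+1); last by lia.
have P0 : P 0 s1.
  by split=> // a; rewrite /s1 /= mE /written; case: ifP => //; rewrite /rows /=; lia.
suff [t [s' [ex tT [? [? ? ?] ? ? ?]]]] : runs (While (Minus (Reg 0) (Reg 2))
    (Seq (If (Read (Plus (Reg 1) (Reg 2))) copy_row Skip)
    (Seq (increment 2 (Lit 1))
         (increment 3 (Reg 0))))) s1 (n * (5 * n + 5).+1).+1 (P n).
  by exists t, s'; split.
apply: runs_while => [i s' lti [m' [r0' r1' r4'] r2 r3 r5]
  |s' [m' [r0' r1' r4'] r2 r3 r5]|//]; last first.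
  by rewrite /= r0' r2 subnn.
rewrite /= r0' r2; split; first by lia.
have szn : size (rows i) <= n * n by apply: leq_trans (size_rows i) _; nia.
have rowsS : rows i.+1 = if flag i != 0 then
    rows i ++ [seq entry i y | y <- kept_below n] else rows i.
  by rewrite /rows kept_belowS; case: ifP => // _; rewrite allpairs_rcons.
rewrite -[X in _ + X]/(3 + 2) addnA; apply: runs_seq; rewrite addnS.
apply: runs_if => /=; rewrite r1' r2 m' written_flag // => fi.
  have [t [s2 [ex tT [m2 f2 r52]]]] := copy_rowP lti r0' r1' r3 r5 m'.
  exists t, s2; split=> //; apply: runs_assign_seq; apply: runs_assign.
  split; rewrite ?rowsS ?fi /update /= ?r52 ?f2 // ?r0' ?r2 ?r3 ?mulSn ?addn1 //; lia.
rewrite addnS; apply: runs_skip; apply: runs_assign_seq; apply: runs_assign.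
split; rewrite ?rowsS ?fi /update /= ?r0' ?r2 ?r3 ?mulSn ?addn1 //; lia.
Qed.

Lemma kernel_cmdP s : mem s = m0 ->
  runs kernel_cmd s (40 * n.+1 ^ 3)
    (fun s' => outputs s' [:: size (kept_below n), m0 1 & rows n]).
Proof.
move=> mE.
(* The phases cost [6n^3 + 12n^2 + 19n + 13] altogether, well below the bound. *)
apply: (@runs_le ((3 * n + 4) + ((n * (n * (6 * n + 7) + 10) + 4) +
   ((n * (5 * n + 6) + 4) + 1)))); last first.
  by rewrite !expnS expn0; nia.
apply: runs_seq; have [t1 [s1 [ex1 tT1 [m1 r0 r1]]]] := prologueP mE.
exists t1, s1; split=> //; apply: runs_seq.
have [t2 [s2 [ex2 tT2 [m2 r02 r12 r4]]]] := flag_verticesP m1 r0 r1.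
exists t2, s2; split=> //; apply: runs_seq.
have [t3 [s3 [ex3 tT3 [m3 r43]]]] := copy_rowsP r02 r12 m2.
exists t3, s3; split=> //; apply: runs_store.
(* Address 0 receives the new order, address 1 still holds the first player, and the compacted
   matrix follows. *)
case=> [|[|i]] /= lti; first by rewrite updateE r43 r4.
  by rewrite /update /= m3.
rewrite /update /= m3 (_ : i.+2 = 2 + i) // /written leq_addr ltn_add2l addKn.
by rewrite ifT.
Qed.

End Kernelization.

(** * From the encoded matrix back to the graph *)

Lemma nth_allpairs (S T R : Type) (f : S -> T -> R) (s : seq S) (t : seq T)
    x0 y0 z0 i j : i < size s -> j < size t ->
  nth z0 [seq f x y | x <- s, y <- t] (i * size t + j) = f (nth x0 s i) (nth y0 t j).
Proof.
elim: s i => [|x s IH] [|i] //= lti ltj; rewrite nth_cat size_map.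
  by rewrite add0n ltj (nth_map y0).
by rewrite mulSn -addnA ltnNge leq_addr /= addKn IH.
Qed.

Lemma allpairs_tnth T R k (f : T -> T -> R) (t : k.-tuple T) :
  [seq f (tnth t i) (tnth t j) | i <- enum 'I_k, j <- enum 'I_k] =
  [seq f x y | x <- t, y <- t].
Proof.
by symmetry; rewrite -{1 2}(map_tnth_enum t) allpairs_mapl allpairs_mapr.
Qed.

Section Encoding.

Variable I : instance.
Let G := igraph I.
Let n := order G.
Let m0 := nth 0 (encode I).

Lemma entryE (u v : vertex G) : entry n m0 u v = adj u v.
Proof.
rewrite /entry /m0 /encode -addnA -{1}(size_enum_ord n) add2n /=.
by rewrite (nth_allpairs _ u u) ?size_enum_ord // !nth_ord_enum.
Qed.

Lemma twinsE (u v : vertex G) : twins n m0 u v = same_type u v.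
Proof.
apply/allP/eqP => [H|/setP H w].
  apply/setP => w; rewrite !inE.
  have := H w; rewrite mem_iota ltn_ord => /(_ isT).
  rewrite !entryE !(inj_eq val_inj) => /or3P[/eqP->|/eqP->|/eqP].
  - by rewrite eqxx adj_irr andbF.
  - by rewrite eqxx adj_irr andbF.
  have [->|wu] := eqVneq w u; first by rewrite adj_irr andbF.
  have [->|wv] := eqVneq w v; first by rewrite adj_irr.
  by rewrite /=; do 2!case: adj.
rewrite mem_iota => /= ltw; have := H (Ordinal ltw); rewrite !inE.
have := entryE u (Ordinal ltw); have := entryE v (Ordinal ltw); rewrite /= => -> ->.
case: (eqVneq (Ordinal ltw) u) => [<-|wu]; first by rewrite /= eqxx.
case: (eqVneq (Ordinal ltw) v) => [<-|wv]; first by rewrite /= eqxx orbT.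
by move=> /= ->; rewrite eqxx !orbT.
Qed.

Lemma flagE (v : vertex G) : (flag n m0 v != 0) = kept v.
Proof.
rewrite /flag subn_eq0 -ltnNge /kept; congr (_ < 2).
(* Initial segments become filters of the full range, so that counting numbers below [v] turns into
   counting vertices. *)
have ev k m : k <= m -> iota 0 k = [seq u <- iota 0 m | u < k].
  move=> lekm; rewrite -(subnKC lekm) iotaD filter_cat.
  rewrite (eq_in_filter (a2 := predT)) => [|u]; last by rewrite mem_iota.
  rewrite filter_predT (eq_in_filter (a2 := pred0)) => [|u]; last first.
    by rewrite mem_iota add0n => /andP[le _]; apply/negbTE; rewrite -leqNgt.
  by rewrite filter_pred0 cats0.
rewrite (ev v n (ltnW (ltn_ord v))) -val_enum_ord filter_map count_map count_filter.
rewrite -size_filter -(card_uniqP (filter_uniq _ (enum_uniq _))).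
by apply: eq_card => u; rewrite mem_filter mem_enum !inE /= twinsE andbT andbC.
Qed.

Lemma kept_belowE : kept_below n m0 n = [seq val v | v <- kept_seq G].
Proof.
rewrite /kept_below -val_enum_ord filter_map; congr (map _ _).
exact/eq_filter/flagE.
Qed.

Lemma encode_kernel :
  encode (kernel I) = [:: size (kept_below n m0 n), m0 1 & rows n m0 n].
Proof.
rewrite /encode kept_belowE size_map; congr [:: _, _ & _].
rewrite /rows kept_belowE; symmetry.
rewrite allpairs_mapl allpairs_mapr -(allpairs_tnth _ (in_tuple (kept_seq G))).
by apply: eq_allpairs => i j; rewrite entryE.
Qed.

End Encoding.

(** * Polynomial time and the linear kernel *)

Lemma kernel_polynomial : polynomial_time kernel.
Proof.
exists kernel_cmd, 40, 3 => I; rewrite encode_kernel.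
pose n := order (igraph I).
have [t [s [ex tT out]]] :=
  @kernel_cmdP n (nth 0 (encode I)) erefl (initial_state (encode I)) erefl.
exists t, s; split=> //; apply: leq_trans tT _; rewrite leq_mul2l leq_exp2r //.
(* The input has length [n^2 + 2], which is at least [n + 1], so the cubic bound in [n + 1] is also
   one in the input length. *)
by rewrite /encode /= size_allpairs size_enum_ord -/n; nia.
Qed.

Theorem theorem4p2 :
  exists f : instance -> instance,
    linear_kernel (fun I => neighborhood_diversity (igraph I)) f.
Proof.
exists kernel; split; [exact: kernel_polynomial | exact: kernel_equivalent|].
by exists 2; apply: kernel_linear.
Qed.
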